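(* Let a task consist of finitely many reasoning steps $i=1,\dots,n$ ($n\ge 1$), and let $\mathrm{PU}_i(N)\in(0,1)$ be the success rate of step $i$ as a function of the model size $N>0$. Suppose each step's success rate obeys scaling law growth, i.e. there are constants $c_i>0$, $\alpha_i>0$ with $\mathrm{PU}_i(N)=\exp(-c_iN^{-\alpha_i})$ for all $N>0$. Then the multi-step success rate $\mathrm{PU}(N)=\prod_{i=1}^n \mathrm{PU}_i(N)$ follows sub-scaling law growth, i.e. $F(N)=\log(-\log \mathrm{PU}(N))$ is a convex function of $\log N$.
   Context: $N$ is the number of non-embedding parameters of a model, treated as a continuous positive variable. For a success rate $\mathrm{PU}(N)\in(0,1)$ that is a continuous function of $N$, put $F(N)=\log(-\log(\mathrm{PU}(N)))$. The success rate obeys scaling law growth if $F(N)$ is a linear (affine) function of $\log N$, i.e. $F(N)=\log c-\alpha\log N$, equivalently $\mathrm{PU}(N)=\exp(-cN^{-\alpha})$, where the coefficients $c,\alpha$ are positive. It obeys sub-scaling law growth if $F(N)$ is a convex function of $\log N$ (not necessarily strictly convex). The success rate of a multi-step task is the product of the success rates of its steps. *)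

(* Defs.v *)
From mathcomp Require Import all_boot all_order all_algebra.
From mathcomp Require Import all_classical all_reals all_analysis.
Set Implicit Arguments.
Unset Strict Implicit.
Unset Printing Implicit Defensive.
Import Order.TTheory GRing.Theory Num.Theory.
Import numFieldNormedType.Exports.
Local Open Scope classical_set_scope.
Local Open Scope ring_scope.

(* The model size ranges over the positive reals: the values of a function
   [PU : R -> R] at nonpositive arguments are never constrained or used. *)
Definition success_rate (R : realType) (PU : R -> R) : Prop :=
  forall N : R, 0 < N -> 0 < PU N < 1 /\ {for N, continuous PU}.

Definition loglog (R : realType) (PU : R -> R) (N : R) : R :=
  ln (- ln (PU N)).

Definition scaling_law_growth (R : realType) (PU : R -> R) : Prop :=
  success_rate PU /\
  exists c alpha : R, [/\ 0 < c, 0 < alpha &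
    forall N : R, 0 < N -> PU N = expR (- (c * N `^ (- alpha)))].

(* [ln] maps the positive reals onto the whole line, hence the domain [setT]. *)
Definition convex_function_of_log (R : realType) (F : R -> R) : Prop :=
  exists G : R^o -> R^o,
    convex_function setT G /\ forall N : R, 0 < N -> F N = G (ln N).

(* [success_rate PU] keeps [loglog PU] away from the conventional values of
   [ln] at nonpositive arguments. *)
Definition sub_scaling_law_growth (R : realType) (PU : R -> R) : Prop :=
  success_rate PU /\ convex_function_of_log (loglog PU).

Lemma scaling_law_growthE (R : realType) (PU : R -> R) :
  scaling_law_growth PU <->
  success_rate PU /\
  exists c alpha : R, [/\ 0 < c, 0 < alpha &
    forall N : R, 0 < N -> loglog PU N = ln c - alpha * ln N].
Proof.
split=> -[PUs [c [a [c0 a0 PUE]]]]; split=> //; exists c, a; split=> // N N0.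
  rewrite /loglog PUE// expRK opprK lnM ?posrE ?powR_gt0//.
  by rewrite ln_powR mulNr.
have [/andP[PU0 PU1] _] := PUs N N0.
have lnPU : 0 < - ln (PU N) by rewrite oppr_gt0 ln_lt0// PU0.
have : - ln (PU N) = c * N `^ (- a).
  apply: ln_inj; rewrite ?posrE ?mulr_gt0 ?powR_gt0//.
  rewrite lnM ?posrE ?powR_gt0// ln_powR mulNr.
  exact: PUE.
by move=> <-; rewrite opprK lnK ?posrE.
Qed.

(* Main.v *)
Require Import Defs.
From mathcomp Require Import all_boot all_order all_algebra.
From mathcomp Require Import all_classical all_reals all_analysis.
From mathcomp Require Import ring.
Set Implicit Arguments.
Unset Strict Implicit.
Unset Printing Implicit Defensive.
Import Order.TTheory GRing.Theory Num.Theory.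
Import numFieldNormedType.Exports.
Local Open Scope ring_scope.

(** In the variable [x = ln N], the function [F] is the log-sum-exp of the
    affine functions [ln (c i) - alpha i * x]. Log-sum-exp is convex and
    affine functions commute with convex combinations. Convexity of log-sum-exp
    reduces to that of [expR] applied termwise, once both families of exponents
    are shifted so that their exponentials sum to [1]. *)

Lemma sum_expR_gt0 (R : realType) (I : finType) (i0 : I) (u : I -> R) :
  0 < \sum_i expR (u i).
Proof.
rewrite (bigD1 i0)//= ltr_pwDl ?expR_gt0//.
by apply: sumr_ge0 => i _; exact: expR_ge0.
Qed.

Lemma ln_sum_expR_convex (R : realType) (I : finType) (i0 : I)
    (t : {i01 R}) (u v : I -> R^o) :
  ln (\sum_i expR (conv t (u i) (v i))) <=
  conv t (ln (\sum_i expR (u i)) : R^o) (ln (\sum_i expR (v i)) : R^o).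
Proof.
have sum_normalized (w : I -> R) :
    \sum_i expR (w i - ln (\sum_j expR (w j))) = 1.
  under eq_bigr do rewrite expRB.
  by rewrite -mulr_suml lnK ?posrE ?divff ?gt_eqF// (sum_expR_gt0 i0).
set A : R^o := ln (\sum_i expR (u i)); set B : R^o := ln (\sum_i expR (v i)).
rewrite -ler_expR lnK ?posrE ?(sum_expR_gt0 i0)//.
(* Since [conv] acts linearly on pairs, undoing both shifts costs the same factor
   [expR (conv t A B)] in every term. What remains is that the shifted sum is at most 1. *)
have -> : \sum_i expR (conv t (u i) (v i)) =
    (\sum_i expR (conv t (u i - A : R^o) (v i - B : R^o))) * expR (conv t A B).
  rewrite mulr_suml; apply: eq_bigr => i _; rewrite -expRD; congr expR.
  by rewrite !convRE; ring.
rewrite ger_pMl ?expR_gt0//.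
(* The termwise bound adds up to the convex combination of two normalized sums, which is 1. *)
apply: le_trans (ler_sum _ (fun i _ => convex_expR t (u i - A) (v i - B))) _.
under eq_bigr do rewrite convRE.
by rewrite big_split/= -!mulr_sumr !sum_normalized !mulr1 subrKC.
Qed.

(** The factor at [i0] is below 1 and the others are at most 1; having an index excludes the empty
    product, which is 1. *)
Lemma prodr_itv01 (R : numDomainType) (I : finType) (i0 : I) (f : I -> R) :
  (forall i, 0 < f i < 1) -> 0 < \prod_i f i < 1.
Proof.
move=> f01; have f0 i : 0 < f i by case/andP: (f01 i).
have f1 i : f i < 1 by case/andP: (f01 i).
rewrite prodr_gt0//= (bigD1 i0)//=.
apply: le_lt_trans (f1 i0); rewrite ger_pMr//.
by apply: prodr_ile1 => i; rewrite !ltW.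
Qed.

Lemma success_rate_prod (R : realType) (I : finType) (i0 : I)
    (PU : I -> R -> R) :
  (forall i, success_rate (PU i)) ->
  success_rate (fun N => \prod_i PU i N).
Proof.
move=> PUs N N0; split.
  by apply: (prodr_itv01 i0) => i; case: (PUs i N N0).
apply: cvg_big => [|i _]; first exact: mul_continuous.
by case: (PUs i N N0).
Qed.

Theorem theorem2 (R : realType) (n : nat) (hn : (0 < n)%N)
    (PU : 'I_n -> R -> R)
    (hPU : forall i : 'I_n, scaling_law_growth (PU i)) :
  sub_scaling_law_growth (fun N : R => \prod_(i < n) PU i N).
Proof.
have i0 : 'I_n := Ordinal hn.
split; first by apply: (success_rate_prod i0) => i; case: (hPU i).
have /choice[c /choice[a ca]] : forall i, exists c a : R, [/\ 0 < c, 0 < a &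
    forall N, 0 < N -> PU i N = expR (- (c * N `^ (- a)))].
  by move=> i; case: (hPU i).
(* At [x = ln N] the summand is $c_i N^{-a_i}$, the negated logarithm of [PU i N]; the logarithm
   turns the product into this sum. *)
exists (fun x => ln (\sum_i expR (ln (c i) - a i * x))); split.
  move=> t x y _ _.
  apply: le_trans (ln_sum_expR_convex i0 t (fun i => ln (c i) - a i * x)
    (fun i => ln (c i) - a i * y)).
  (* The two sides agree, because the exponents are affine in [x]. *)
  rewrite le_eqVlt; apply/orP; left; apply/eqP; congr ln.
  apply: eq_bigr => i _; congr expR.
  by rewrite convRE [conv t x y]convRE /unstable.onem; ring.
move=> N N0; rewrite /loglog; congr ln.
under eq_bigr => i _ do [have [_ _ ->//] := ca i].
rewrite -expR_sum expRK sumrN opprK; apply: eq_bigr => i _.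
have [c0 _ _] := ca i.
(* [powR] treats base 0 separately; [0 < N] selects its exponential branch. *)
by rewrite expRD lnK ?posrE// /powR gt_eqF// mulNr.
Qed.
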